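(* Let $0<r_{\min}\le r_{\max}$. There is a constant $K>0$, depending only on $r_{\min}$ and $r_{\max}$, such that the following holds. Let $N_r\ge 2$ be an integer (number of antennas, indexed $n=0,\dots,N_r-1$), let $d>0$ (spacing) and $\lambda>0$ (wavelength), and put $k_\lambda=2\pi/\lambda$. Let $I_1,I_2\in\mathbb Z_+$ be positive integers (truncation orders), let $p$ be any bijection from $\{-I_1,\dots,I_1\}\times\{-I_2,\dots,I_2\}$ to $\{1,\dots,P\}$ with $P=(2I_1+1)(2I_2+1)$, and let $r_1,\dots,r_{N_d}>0$ be a grid of distinct ranges. Let $\theta\in(0,\pi)$ and let $r\in[r_{\min},r_{\max}]$ be a point of the grid, i.e. $r=r_i$ for exactly one $i$. With the near-field steering vector $\mathbf a_{\mathrm{NF}}(r,\theta)$, the lifted atom $\mathbf A(r,\theta)\in\mathbb C^{N_d\times N_b}$ and the matrices $\boldsymbol\Phi_n\in\mathbb C^{N_d\times N_b}$ defined in the context, for every $n=0,\dots,N_r-1$, $$a_{\mathrm{NF}}(r,\theta)[n]=\langle \mathbf A(r,\theta),\boldsymbol\Phi_n\rangle+\delta_n(r,\theta),$$ where the error decomposes as $\delta_n(r,\theta)=\delta_n^{\mathrm F}+\delta_n^{\mathrm{tail}}$ for complex numbers $\delta_n^{\mathrm F}$ (Fresnel remainder) and $\delta_n^{\mathrm{tail}}$ (Bessel truncation tail) satisfying $$|\delta_n^{\mathrm F}|\le K\,k_\lambda\frac{n^3d^3}{r^3}$$ and $$|\delta_n^{\mathrm{tail}}|\le \sum_{|\ell|>I_1}\sum_{q\in\mathbb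 Z}|J_\ell(z_1(n))|\,|J_q(z_2(n,r))|+\sum_{|q|>I_2}\sum_{\ell\in\mathbb Z}|J_\ell(z_1(n))|\,|J_q(z_2(n,r))|,$$ where $z_1(n)=k_\lambda nd$, $z_2(n,r)=k_\lambda\frac{n^2d^2}{4r}$, and $\ell,q$ range over integers.
   Context: Throughout, $j$ is the imaginary unit and $J_m$ ($m\in\mathbb Z$) is the Bessel function of the first kind of order $m$. $\mathrm{vec}(\cdot)$ stacks the columns of a matrix, $\otimes$ is the Kronecker product, $\mathbf e_m\in\mathbb R^{N_r}$ is the $m$-th canonical basis (column) vector, $^{\mathsf T}$ is transpose and $^{\mathsf H}$ is conjugate transpose. The matrix inner product is $\langle \mathbf X,\mathbf Y\rangle=\mathrm{Tr}(\mathbf X^{\mathsf H}\mathbf Y)$. Near-field steering vector: for a point with polar coordinates $(r,\theta)$ relative to antenna $0$, let $r^{(n)}=\sqrt{r^2+(nd)^2-2r(nd)\cos\theta}$, and set $a_{\mathrm{NF}}(r,\theta)[n]=\exp\big(-jk_\lambda(r^{(n)}-r)\big)$ for $n=0,\dots,N_r-1$. Sizes: $P=(2I_1+1)(2I_2+1)$, $I_{\mathrm{off}}=I_1+2I_2$, $N_b=2I_{\mathrm{off}}+1$. Normalized Vandermonde vector: $\widetilde{\mathbf v}(\theta)=\frac1{\sqrt{N_b}}\big[e^{-jI_{\mathrm{off}}\theta},e^{-j(I_{\mathrm{off}}-1)\theta},\dots,e^{jI_{\mathrm{off}}\theta}\big]^{\mathsf T}\in\mathbb C^{N_b}$. Selection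 matrix: $\mathbf S\in\{0,1\}^{P\times N_b}$ has $S[p(\ell,q),\,\ell+2q+I_{\mathrm{off}}+1]=1$ for all $|\ell|\le I_1$, $|q|\le I_2$, and all other entries zero (rows and columns indexed from $1$). Coefficient matrix: for $\rho>0$, $\mathbf C(\rho)\in\mathbb C^{N_r\times P}$ has, in the row corresponding to antenna $n$ (that is, the $(n+1)$-th row, $n=0,\dots,N_r-1$) and column $p(\ell,q)$, the entry $e^{-jz_2(n,\rho)}\,j^{\ell+q}\,J_\ell(z_1(n))\,J_q(z_2(n,\rho))$, where $z_1(n)=k_\lambda nd$ and $z_2(n,\rho)=k_\lambda\frac{n^2d^2}{4\rho}$. Range dictionary: $\mathbf D=\big[\mathrm{vec}(\mathbf C(r_1))\ \cdots\ \mathrm{vec}(\mathbf C(r_{N_d}))\big]\in\mathbb C^{N_rP\times N_d}$. Lifted atom: for $r$ in the grid, $\boldsymbol\alpha\in\{0,1\}^{N_d}$ is the one-sparse vector with $\alpha[i]=1$ if and only if $r=r_i$, and $\mathbf A(r,\theta)=\boldsymbol\alpha\,\widetilde{\mathbf v}(\theta)^{\mathsf H}\in\mathbb C^{N_d\times N_b}$. Measurement matrices: $\boldsymbol\Phi_n=\sqrt{N_b}\,\mathbf D^{\mathsf T}(\mathbf I_P\otimes\mathbf e_{n+1})\,\mathbf S\in\mathbb C^{N_d\times N_b}$ for $n=0,\dots,N_r-1$, where $\mathbf I_P$ is the $P\times P$ identity. *)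

(* Defs.v *)
From mathcomp Require Export all_boot all_order all_algebra.
From mathcomp Require Export all_classical all_reals all_analysis.
From mathcomp Require Export complex mxtens.

Set Implicit Arguments.
Unset Strict Implicit.
Unset Printing Implicit Defensive.

Export Order.TTheory GRing.Theory Num.Theory.
Export numFieldNormedType.Exports.

Local Open Scope ring_scope.
Local Open Scope complex_scope.
Local Open Scope sesquilinear_scope.

(* Rows, columns and antennas are indexed from 0 throughout. *)

Definition cexp (R : realType) (z : R[i]) : R[i] :=
  (expR (complex.Re z))%:C * (cos (complex.Im z) +i* sin (complex.Im z)).

(* J_m(x) = sum_{k >= 0} (-1)^k / (k! (k+m)!) (x/2)^(2k+m) for m >= 0. *)
Definition besselJ_nat (R : realType) (m : nat) (x : R) : R :=
  limn (series (fun k : nat =>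
    (-1) ^+ k / (k`! * (k + m)`!)%:R * (x / 2) ^+ (2 * k + m))).

(* J_{-m} = (-1)^m J_m, i.e. the same series with 1/Gamma = 0 at the poles;
   Negz m is - m.+1. *)
Definition besselJ (R : realType) (m : int) (x : R) : R :=
  match m with
  | Posz m => besselJ_nat m x
  | Negz m => (-1) ^+ m.+1 * besselJ_nat m.+1 x
  end.

Definition mxinner (R : realType) (m n : nat) (X Y : 'M[R[i]]_(m, n)) : R[i] :=
  \tr (X ^t* *m Y).

(* Column-stacking: entry j * m + i is A i j.  (mxvec is row-major; this is the
   ordering under which *t is the usual Kronecker product.) *)
Definition vec (T : Type) (m n : nat) (A : 'M[T]_(m, n)) : 'cV[T]_(n * m) :=
  \col_k A (mxtens_unindex k).2 (mxtens_unindex k).1.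

Definition wavenumber (R : realType) (lam : R) : R := 2 * pi / lam.

Definition range_at (R : realType) (d r theta : R) (n : nat) : R :=
  Num.sqrt (r ^+ 2 + (n%:R * d) ^+ 2 - 2 * r * (n%:R * d) * cos theta).

Definition steeringNF (R : realType) (k d r theta : R) (n : nat) : R[i] :=
  cexp (- 'i%C * (k * (range_at d r theta n - r))%:C).

Definition z1 (R : realType) (k d : R) (n : nat) : R := k * n%:R * d.

Definition z2 (R : realType) (k d : R) (n : nat) (rho : R) : R :=
  k * (n%:R ^+ 2 * d ^+ 2 / (4 * rho)).

Definition nbP (I1 I2 : nat) : nat := (2 * I1 + 1) * (2 * I2 + 1).
Definition Ioff (I1 I2 : nat) : nat := I1 + 2 * I2.
Definition Nb (I1 I2 : nat) : nat := 2 * Ioff I1 I2 + 1.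

(* The integer range {-I, ..., I} is represented by 'I_(2 * I + 1), the
   ordinal i standing for the integer i - I. *)
Definition centered (I : nat) (i : 'I_(2 * I + 1)) : int := i%:Z - I%:Z.

Definition pairs (I1 I2 : nat) : Type :=
  ('I_(2 * I1 + 1) * 'I_(2 * I2 + 1))%type.

Definition vandermonde (R : realType) (I1 I2 : nat) (theta : R) :
    'cV[R[i]]_(Nb I1 I2) :=
  \col_b (((Num.sqrt (Nb I1 I2)%:R)^-1)%:C *
          cexp ('i%C * ((b%:Z - (Ioff I1 I2)%:Z)%:~R * theta)%:C)).

Definition selection (R : realType) (I1 I2 : nat)
    (p : pairs I1 I2 -> 'I_(nbP I1 I2)) : 'M[R[i]]_(nbP I1 I2, Nb I1 I2) :=
  \matrix_(a, b)
    [exists l, exists q, (a == p (l, q)) &&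
       (b%:Z == centered l + 2 * centered q + (Ioff I1 I2)%:Z)]%:R.

(* For bijective p the sum in column a has exactly one term, the pair (l, q)
   with p (l, q) = a. *)
Definition coefmx (R : realType) (Nr I1 I2 : nat)
    (p : pairs I1 I2 -> 'I_(nbP I1 I2)) (k d rho : R) :
    'M[R[i]]_(Nr, nbP I1 I2) :=
  \matrix_(n, a) \sum_(lq | p lq == a)
    (cexp (- 'i%C * (z2 k d n rho)%:C) *
     'i%C ^ (centered lq.1 + centered lq.2) *
     (besselJ (centered lq.1) (z1 k d n))%:C *
     (besselJ (centered lq.2) (z2 k d n rho))%:C).

Definition dictionary (R : realType) (Nr Nd I1 I2 : nat)
    (p : pairs I1 I2 -> 'I_(nbP I1 I2)) (k d : R) (rg : 'I_Nd -> R) :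
    'M[R[i]]_(nbP I1 I2 * Nr, Nd) :=
  \matrix_(s, i) vec (coefmx Nr p k d (rg i)) s 0.

Definition lifted_atom (R : realType) (Nd I1 I2 : nat) (rg : 'I_Nd -> R)
    (r theta : R) : 'M[R[i]]_(Nd, Nb I1 I2) :=
  (\col_i (r == rg i)%:R) *m (vandermonde I1 I2 theta) ^t*.

(* The cast only identifies the column count P * 1 of the Kronecker product
   with P. *)
Definition measmx (R : realType) (Nr Nd I1 I2 : nat)
    (p : pairs I1 I2 -> 'I_(nbP I1 I2)) (k d : R) (rg : 'I_Nd -> R)
    (n : 'I_Nr) : 'M[R[i]]_(Nd, Nb I1 I2) :=
  (Num.sqrt (Nb I1 I2)%:R)%:C *:
    ((dictionary Nr p k d rg)^T *m
     castmx (erefl, muln1 (nbP I1 I2))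
       (1%:M *t (delta_mx n 0 : 'cV[R[i]]_Nr)) *m
     selection R p).

(* Main.v *)
(* The Fresnel expansion of the range has remainder O(x^3), x = n d / r, uniformly
   in x >= 0: for small x compare squares, for x >= 1/2 every term is O(x^3) by itself.
   Since t |-> e^(it) is 1-Lipschitz this bounds the Fresnel error with K = 25 r_max.
   The Fresnel phase is - z2 + z1 cos theta + z2 cos (2 theta), so by Jacobi-Anger it
   factors as e^(-j z2) times two Bessel series; the measurement is exactly the product of
   their truncations, and the difference of the products is at most the two tails. *)
Require Import Defs.
From mathcomp Require Import ring lra zify.

Set Implicit Arguments.
Unset Strict Implicit.
Unset Printing Implicit Defensive.
Local Open Scope classical_set_scope.
Local Open Scope ring_scope.
Local Open Scope complex_scope.

Local Notation normc := ComplexField.Normc.normc.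

(** * Modulus of complex numbers and exponentials on the unit circle *)

Section ComplexModulus.
Variable R : realType.
Implicit Types (x y : R) (z w : R[i]).

Lemma normcD z w : normc (z + w) <= normc z + normc w.
Proof. exact: le_normcD. Qed.

Lemma normcM z w : normc (z * w) = normc z * normc w.
Proof. exact: ComplexField.Normc.normcM. Qed.

Lemma normc_ge0 z : 0 <= normc z.
Proof. by case: z => a b; rewrite /normc sqrtr_ge0. Qed.

Lemma normc_real x : normc x%:C = `|x|.
Proof. by rewrite /normc /= expr0n addr0 sqrtr_sqr. Qed.

Lemma normc_le_abs x y : normc (x +i* y) <= `|x| + `|y|.
Proof.
rewrite /normc -[leRHS]ger0_norm ?addr_ge0// -sqrtr_sqr ler_wsqrtr//.
rewrite sqrrD !real_normK ?num_real// lerD2r lerDl.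
by rewrite mulrn_wge0// mulr_ge0.
Qed.

Lemma normc_sum I (s : seq I) (P : pred I) (F : I -> R[i]) :
  normc (\sum_(i <- s | P i) F i) <= \sum_(i <- s | P i) normc (F i).
Proof.
elim/big_ind2: _ => //; first by rewrite ComplexField.Normc.normc0.
by move=> a b c d hb hd; rewrite (le_trans (normcD _ _))// lerD.
Qed.

Lemma normcX z n : normc (z ^+ n) = normc z ^+ n.
Proof.
elim: n => [|n IH]; first by rewrite !expr0 ComplexField.Normc.normc1.
by rewrite !exprS normcM IH.
Qed.

Lemma normc_unit_exprz z (m : int) : normc z = 1 -> normc (z ^ m) = 1.
Proof.
move=> hz; case: m => n; rewrite /exprz /=.
  by rewrite normcX hz expr1n.
by rewrite ComplexField.Normc.normcV normcX hz expr1n invr1.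
Qed.

Lemma normc_i : normc ('i : R[i]) = 1.
Proof. by rewrite /normc /= expr0n add0r expr1n sqrtr1. Qed.

Lemma cexp_iE x : cexp ('i * x%:C) = cos x +i* sin x.
Proof.
rewrite /cexp; have -> : 'i * x%:C = 0 +i* x by simpc.
by rewrite /= expR0 mul1r.
Qed.

Lemma cexp_NiE x : cexp (- 'i * x%:C) = cexp ('i * (- x)%:C).
Proof. by rewrite rmorphN mulrN mulNr. Qed.

Lemma cexp_iD x y : cexp ('i * (x + y)%:C) = cexp ('i * x%:C) * cexp ('i * y%:C).
Proof.
rewrite !cexp_iE cosD sinD; apply/eqP; rewrite eq_complex /=.
by rewrite eqxx /=; apply/eqP; ring.
Qed.

Lemma cexp_i0 : cexp ('i * (0 : R)%:C) = 1.
Proof. by rewrite cexp_iE cos0 sin0. Qed.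

Lemma normc_cexp_i x : normc (cexp ('i * x%:C)) = 1.
Proof. by rewrite cexp_iE /normc cos2Dsin2 sqrtr1. Qed.

Lemma cexp_iN x : cexp ('i * (- x)%:C) = (cexp ('i * x%:C))^-1.
Proof.
have h : cexp ('i * (- x)%:C) * cexp ('i * x%:C) = 1.
  by rewrite -cexp_iD addNr cexp_i0.
have nz : cexp ('i * x%:C) != 0.
  by apply/eqP => e; move: h; rewrite e mulr0 => /esym/eqP; rewrite oner_eq0.
by apply: (mulIf nz); rewrite h mulVf.
Qed.

Lemma cexp_iMn x (n : nat) : cexp ('i * (n%:R * x)%:C) = cexp ('i * x%:C) ^+ n.
Proof.
elim: n => [|n IH]; first by rewrite mul0r cexp_i0.
by rewrite -natr1 mulrDl mul1r cexp_iD IH exprSr.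
Qed.

Lemma cexp_iMz x (m : int) : cexp ('i * (m%:~R * x)%:C) = cexp ('i * x%:C) ^ m.
Proof.
case: m => n; first exact: cexp_iMn.
by rewrite NegzE mulrNz mulNr cexp_iN cexp_iMn.
Qed.

Lemma sin_le_abs x : `|sin x| <= `|x|.
Proof.
wlog x0 : x / 0 <= x.
  move=> H; case: (leP 0 x) => [|/ltW x0]; first exact: H.
  by rewrite -(normrN x) -(normrN (sin x)) -sinN; apply: H; lra.
have [|c _] := @MVT_segment R sin cos 0 x x0.
  by apply: continuous_subspaceT => y; exact: continuous_sin.
rewrite sin0 !subr0 => ->; rewrite normrM ler_piMl//.
by rewrite ler_norml cos_geN1 cos_le1.
Qed.

(** The squared chord is [2 - 2 * cos (x - y) = 4 * sin ((x - y) / 2) ^+ 2], and the sine is at most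
    its argument in absolute value. *)
Lemma cexp_i_lipschitz x y :
  normc (cexp ('i * x%:C) - cexp ('i * y%:C)) <= `|x - y|.
Proof.
rewrite !cexp_iE -sqrtr_sqr ler_wsqrtr//=.
have -> : (cos x - cos y) ^+ 2 + (sin x - sin y) ^+ 2 = 2 - 2 * cos (x - y).
  have := cos2Dsin2 x; have := cos2Dsin2 y; rewrite cosB; nra.
have -> : x - y = (x - y) / 2 + (x - y) / 2 by field.
set h := (x - y) / 2; rewrite cosD.
have h1 := cos2Dsin2 h.
have : sin h ^+ 2 <= h ^+ 2.
  rewrite -[sin h ^+ 2]real_normK ?num_real// -[h ^+ 2]real_normK ?num_real//.
  by rewrite lerXn2r ?nnegrE// sin_le_abs.
nra.
Qed.

End ComplexModulus.

(** * Second-order expansion of the normalised range *)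

Lemma fresnel_sqrt_remainder (R : rcfType) (x c : R) : 0 <= x -> `|c| <= 1 ->
  `|Num.sqrt (1 - 2 * x * c + x ^+ 2) - 1 + x * c - x ^+ 2 * (1 - c ^+ 2) / 2|
    <= 25 * x ^+ 3.
Proof.
move=> x0; rewrite ler_norml => /andP[c1 c2].
have d0 : 0 <= 1 - c ^+ 2 by nra.
have e0 : 0 <= 1 - 2 * x * c + x ^+ 2 by have := sqr_ge0 (x - c); nra.
set s := Num.sqrt _.
have s0 : 0 <= s by exact: sqrtr_ge0.
have ss : s ^+ 2 = 1 - 2 * x * c + x ^+ 2 by rewrite sqr_sqrtr.
have d1 : 1 - c ^+ 2 <= 1 by nra.
set t := 1 - x * c + x ^+ 2 * (1 - c ^+ 2) / 2.
have -> : s - 1 + x * c - x ^+ 2 * (1 - c ^+ 2) / 2 = s - t by rewrite /t; field.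
(* For small [x], [s ^+ 2] and [t ^+ 2] agree up to order two, so [(s - t) * (s + t)] is at most
   [2 * x ^+ 3] in modulus. Since [s + t >= 1/2], dividing leaves [4 * x ^+ 3]. *)
case: (lerP x (1/2)) => hx.
  have t1 : 1/2 <= t.
    have : x * c <= 1/2 by nra.
    by rewrite /t; have := mulr_ge0 (sqr_ge0 x) d0; lra.
  have e : (s - t) * (s + t) = x ^+ 3 * (c * (1 - c ^+ 2) - x * (1 - c ^+ 2) ^+ 2 / 4).
    have -> : (s - t) * (s + t) = s ^+ 2 - t ^+ 2 by ring.
    by rewrite ss /t; field.
  have b : `|c * (1 - c ^+ 2) - x * (1 - c ^+ 2) ^+ 2 / 4| <= 2.
    set D := 1 - c ^+ 2 in d0 d1 *.
    have : 0 <= D ^+ 2 <= 1 by nra.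
    set E := D ^+ 2 => /andP[E0 E1].
    by rewrite ler_norml; apply/andP; split; nra.
  have x3 : 0 <= x ^+ 3 by rewrite exprn_ge0.
  have : `|s - t| * (s + t) <= x ^+ 3 * 2.
    rewrite -[s + t]ger0_norm; last lra.
    by rewrite -normrM e normrM (ger0_norm x3) ler_wpM2l.
  have := normr_ge0 (s - t); nra.
have s1 : s <= 1 + x.
  rewrite -[1 + x]ger0_norm; last lra.
  by rewrite -sqrtr_sqr ler_wsqrtr//; nra.
(* For [x > 1/2] nothing has to cancel: [1 <= 8 x^3], [x <= 4 x^3] and [x^2 <= 2 x^3] bound the
   terms of [s - t] one by one. With [X] and [x * X] as atoms the goal is linear. *)
have x3 : x ^+ 3 = x * x ^+ 2 by ring.
have x2 : 1/4 <= x ^+ 2 by nra.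
rewrite x3 /t; set X := x ^+ 2 in x2 *.
have : 0 <= X * (1 - c ^+ 2) <= X by nra.
move=> /andP[y0 y1].
have : X / 2 <= x * X by nra.
have : x / 4 <= x * X by nra.
have : - x <= x * c <= x by nra.
move=> /andP[w0 w1] ? ?.
by rewrite ler_norml; apply/andP; split; lra.
Qed.

(** * Regrouping finite double sums *)

Section FiniteSums.
Variable V : nmodType.

(** The triangle [b <= a < M] is read along its diagonals [m = a - b]. In the induction the new row
    [a = M] adds one last term, at [b = M - m], to each diagonal. *)
Lemma sum_lower_diag (g : nat -> nat -> V) M :
  \sum_(a < M) \sum_(b < a.+1) g a b =
  \sum_(m < M) \sum_(k < M - m) g (k + m)%N k.
Proof.
elim: M => [|M IH]; first by rewrite !big_ord0.
have -> : \sum_(m < M.+1) \sum_(k < M.+1 - m) g (k + m)%N k =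
    \sum_(m < M.+1) (\sum_(k < M - m) g (k + m)%N k + g M (M - m)%N).
  apply: eq_bigr => m _; rewrite subSn ?big_ord_recr /= -1?ltnS//.
  by rewrite subnK// -ltnS.
rewrite big_split /= [X in _ = X + _]big_ord_recr /= subnn big_ord0 addr0 -IH.
rewrite big_ord_recr /=; congr (_ + _).
rewrite (reindex_inj rev_ord_inj) /=.
by apply: eq_bigr => i _; rewrite subSS.
Qed.

(** Passes from total degree [a + b <= N] to the difference [a - b], which is [m] in the first sum
    and [- m.+1] in the second. The bounds [uphalf] count the [k] with [2 * k + m <= N],
    respectively [2 * k + m.+1 <= N]. This collects the coefficient of each power of [t] in powers
    of a sum of a multiple of [t] and one of its inverse. *)
Lemma sum_antidiag (f : nat -> nat -> V) N :
  \sum_(n < N.+1) \sum_(b < n.+1) f (n - b)%N b =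
  \sum_(m < N.+1) \sum_(k < uphalf (N.+1 - m)) f (k + m)%N k +
  \sum_(m < N) \sum_(k < uphalf (N - m)) f k (k + m.+1)%N.
Proof.
rewrite (sum_lower_diag (fun n b => f (n - b)%N b)).
(* Extending [f] by zero turns the triangle [a + b <= N] into a full square, which can then be cut
   along the diagonal [a = b]. *)
pose g a b := if (a + b < N.+1)%N then f a b else 0.
have restrict (h : nat -> V) A (P : pred nat) (B : nat) : (A <= B)%N ->
    (forall k, (k < B)%N -> P k = (k < A)%N) ->
    \sum_(k < B) (if P k then h k else 0) = \sum_(k < A) h k.
  move=> AB hP; rewrite (big_ord_widen B)// big_mkcond [RHS]big_mkcond /=.
  by apply: eq_bigr => k _; rewrite hP.
have -> : \sum_(m < N.+1) \sum_(k < N.+1 - m) f (k + m - k)%N k =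
    \sum_(a < N.+1) \sum_(b < N.+1) g a b.
  apply: eq_bigr => a _; rewrite /g.
  rewrite (restrict (f a) (N.+1 - a)%N (fun k => (a + k < N.+1)%N)).
  - by apply: eq_bigr => k _; rewrite addKn.
  - exact: leq_subr.
  - by move=> k _; lia.
have -> : \sum_(a < N.+1) \sum_(b < N.+1) g a b =
    \sum_(a < N.+1) \sum_(b < a.+1) g a b +
    \sum_(b < N) \sum_(a < b.+1) g a b.+1.
  transitivity (\sum_(a < N.+1) (\sum_(b < N.+1 | (b < a.+1)%N) g a b +
      \sum_(b < N.+1 | ~~ (b < a.+1)%N) g a b)).
    by apply: eq_bigr => a _; rewrite (bigID (fun b : 'I_N.+1 => (b < a.+1)%N)).
  rewrite big_split /=; congr (_ + _).
    by apply: eq_bigr => a _; rewrite -big_ord_widen// ltn_ord.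
  rewrite (exchange_big_dep xpredT)//= big_ord_recl /=.
  rewrite big_pred0 ?add0r; last by move=> i.
  apply: eq_bigr => b _; rewrite (big_ord_widen N.+1 (fun a => g a b.+1))//=.
    by apply: eq_bigl => a; rewrite /bump add1n; lia.
  by have := ltn_ord b; lia.
rewrite (sum_lower_diag (fun a b => g a b)).
rewrite (sum_lower_diag (fun b a => g a b.+1)).
congr (_ + _); apply: eq_bigr => m _.
  apply: (restrict (fun k => f (k + m)%N k) _ (fun k => (k + m + k < N.+1)%N)).
    by lia.
  by move=> k hk; lia.
have hlt k : (k < N - m)%N ->
    (k + (k + m).+1 < N.+1)%N = (k < uphalf (N - m))%N by lia.
have hle : (uphalf (N - m) <= N - m)%N by lia.
rewrite -(restrict (fun k => f k (k + m.+1)%N) _ _ _ hle hlt).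
by apply: eq_bigr => k _; rewrite /g !addnS.
Qed.

Lemma sum_centered (F : int -> V) N :
  \sum_(i < 2 * N + 1) F (centered i) =
  \sum_(m < N.+1) F m%:Z + \sum_(m < N) F (Negz m).
Proof.
rewrite /centered -(big_mkord xpredT (fun i : nat => F (i%:Z - N%:Z))).
rewrite (big_cat_nat _ (n := N))//=; last by lia.
rewrite addrC; congr (_ + _).
  rewrite -{1}[N]add0n big_addn (_ : 2 * N + 1 - N = N.+1)%N; last by lia.
  by rewrite big_mkord; apply: eq_bigr => i _; rewrite PoszD addrK.
rewrite big_nat_rev big_mkord; apply: eq_bigr => i _; congr F.
by have := ltn_ord i; lia.
Qed.

End FiniteSums.

(** * Series dominated by a geometric series of ratio one half *)

Section GeometricTail.
Variables (R : realType) (u : R^nat).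

Lemma cvg_series_half_bound C : (forall k, `|u k| <= C * (1 / 2) ^+ k) ->
  cvgn (series u).
Proof.
move=> h; apply: normed_cvg.
have C0 : 0 <= C by have := h 0%N; rewrite expr0 mulr1; exact: le_trans.
apply: (@series_le_cvg _ _ (geometric C (1 / 2))) => [n|n|//|].
- exact: normr_ge0.
- by rewrite geometric_ge0//; lra.
- by apply: is_cvg_geometric_series; rewrite ger0_norm; lra.
Qed.

Lemma series_half_tail C K : cvgn (series u) ->
  (forall k, `|u (K + k)%N| <= C * (1 / 2) ^+ k) ->
  `|limn (series u) - series u K| <= 2 * C.
Proof.
move=> cu h.
have C0 : 0 <= C by have := h 0%N; rewrite expr0 mulr1; exact: le_trans.
(* The factor [1 - (1 / 2) ^+ j] sharpens [2 * C] just enough for the induction to close. *)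
have part j : `|series u (K + j)%N - series u K| <= 2 * C * (1 - (1 / 2) ^+ j).
  elim: j => [|j IH]; first by rewrite addn0 subrr normr0 expr0 subrr mulr0.
  rewrite addnS seriesSr.
  have := h j; have := ler_normD (series u (K + j)%N - series u K) (u (K + j)%N).
  rewrite [_ - _ + _]addrAC exprS; lra.
have bnd : \forall n \near \oo, `|series u n - series u K| <= 2 * C.
  exists K => // n /= Kn; rewrite -(subnKC Kn) (le_trans (part _))//.
  have : 0 <= (1 / 2 : R) ^+ (n - K) by rewrite exprn_ge0//; lra.
  nra.
rewrite ler_distl; apply/andP; split.
  apply: limr_ge => //; move: bnd; apply: filterS => n.
  by rewrite ler_distl => /andP[].
apply: limr_le => //; move: bnd; apply: filterS => n.
by rewrite ler_distl => /andP[].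
Qed.

End GeometricTail.

(** * Tails of the Bessel power series *)

Section BesselTail.
Variable R : realType.
Implicit Types (x y : R).

Lemma pow_fact_le y n : 0 <= y -> y ^+ n / n`!%:R <= expR y.
Proof.
move=> y0; case: n => [|n]; first by rewrite expr0 divr1 -expR0 ler_expR.
by apply: le_trans (expR_ge1Dxn n y0); lra.
Qed.

(** The exponential bound is used at [4 * |y|] to gain the decay [(1 / 4) ^+ n]. Half of this rate
    will later pay for the number of Bessel orders. *)
Lemma pow_fact_quarter y n : 
  `|y| ^+ n / n`!%:R <= expR (4 * `|y|) * (1 / 4) ^+ n.
Proof.
have y0 : 0 <= 4 * `|y| by rewrite mulr_ge0.
have := pow_fact_le n y0; rewrite exprMn => h.
rewrite expr_div_n expr1n mulrA mulr1 ler_pdivlMr ?exprn_gt0//.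
by rewrite mulrAC (mulrC (`|y| ^+ n)).
Qed.

Definition bessel_term (m : nat) x (k : nat) : R :=
  (-1) ^+ k / (k`! * (k + m)`!)%:R * (x / 2) ^+ (2 * k + m).

(** Writing [2 * k + m] as [k + (k + m)] pairs one power of [x / 2] with each of the two
    factorials. *)
Lemma bessel_term_le m x k :
  `|bessel_term m x k| <=
    expR (4 * `|x / 2|) ^+ 2 * (1 / 4) ^+ (2 * k + m).
Proof.
rewrite /bessel_term; move: (x / 2) => y.
rewrite normrM normrX normrM normrX normrN1 expr1n (mul1r `|_^-1|) normfV.
rewrite normr_nat natrM invfM.
have -> : (2 * k + m = k + (k + m))%N by lia.
rewrite !exprD; set q := (1 / 4 : R); rewrite [leRHS](_ : _ =
  (expR (4 * `|y|) * q ^+ k) * (expR (4 * `|y|) * (q ^+ k * q ^+ m))); last by ring.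
rewrite mulrACA -!exprD ler_pM ?mulr_ge0 ?invr_ge0 ?exprn_ge0 ?ler0n//;
by rewrite mulrC pow_fact_quarter.
Qed.

(** The rate is expressed in the degree [2 * K + m] of the first omitted term, so that truncating by
    degree gives one bound for all orders [m]. *)
Lemma besselJ_nat_tail m x K :
  `|besselJ_nat m x - \sum_(k < K) bessel_term m x k| <=
    2 * (expR (4 * `|x / 2|) ^+ 2 * (1 / 4) ^+ (2 * K + m)).
Proof.
rewrite -(big_mkord xpredT); set E := expR _ ^+ 2.
have E0 : 0 <= E by rewrite exprn_ge0// expR_ge0.
have bnd j k : `|bessel_term m x (j + k)| <=
    E * (1 / 4) ^+ (2 * j + m) * (1 / 2) ^+ k.
  apply: (le_trans (bessel_term_le _ _ _)).
  have -> : (2 * (j + k) + m = (2 * j + m) + 2 * k)%N by lia.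
  rewrite exprD mulrA; apply: ler_wpM2l.
    by apply: mulr_ge0 => //; rewrite exprn_ge0//; lra.
  by rewrite exprM; apply: lerXn2r; rewrite ?nnegrE; lra.
apply: (@series_half_tail _ (bessel_term m x)).
  by apply: (@cvg_series_half_bound _ _ (E * (1 / 4) ^+ m)) => k; exact: (bnd 0%N).
exact: bnd.
Qed.

End BesselTail.

(** * The Jacobi-Anger expansion *)

Section JacobiAnger.
Variable R : realType.
Implicit Types (x theta s : R) (N : nat).

(** Symmetric partial sum of the Jacobi-Anger series of [e^(i x cos theta)]. *)
Definition bessel_psum N x theta : R[i] :=
  \sum_(i < 2 * N + 1) 'i ^ centered i *
    cexp ('i * ((centered i)%:~R * theta)%:C) * (besselJ (centered i) x)%:C.

Lemma bessel_termC m x k : (bessel_term m x k)%:C =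
  (-1) ^+ k / (k`!%:R * (k + m)`!%:R) * (x / 2)%:C ^+ (2 * k + m) :> R[i].
Proof.
rewrite /bessel_term; move: (x / 2) => y; rewrite natrM.
by rewrite rmorphM /= rmorphXn /= fmorph_div /= rmorphM /= !rmorph_nat rmorph_sign.
Qed.

Lemma iX_double h : ('i : R[i]) ^+ h.*2 = ((-1) ^+ h : R)%:C.
Proof. by rewrite -mul2n exprM sqr_i rmorphXn rmorphN rmorph1. Qed.

Lemma cexp_i_term s n : ('i * s%:C) ^+ n / n`!%:R = cos_coeff s n +i* sin_coeff s n.
Proof.
rewrite exprMn -rmorphXn -[in X in _ / X](rmorph_nat (real_complex R)) -fmorphV.
rewrite /cos_coeff /sin_coeff /=.
have /= := odd_double_half n; case: (odd n) => <- /=.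
  rewrite add1n exprS iX_double /= doubleK !mul0r !mul1r exprnP; simpc.
  by rewrite -!mulrA.
rewrite !add0n iX_double !mul0r !mul1r; simpc.
by rewrite doubleK -!mulrA.
Qed.

(** On the imaginary axis the real and imaginary parts of the exponential series are the cosine and
    sine series, so the complex error is at most the sum of two real errors. *)
Lemma cvg_cexp_i_psum s :
  normc (cexp ('i * s%:C) - \sum_(n < N) ('i * s%:C) ^+ n / n`!%:R)
    @[N --> \oo] --> (0 : R).
Proof.
have cc : series (cos_coeff s) @ \oo --> cos s.
  by rewrite cos.unlock; exact: is_cvg_series_cos_coeff.
have cs : series (sin_coeff s) @ \oo --> sin s.
  by rewrite sin.unlock; exact: is_cvg_series_sin_coeff.
have h0 : `|cos s - series (cos_coeff s) N| + `|sin s - series (sin_coeff s) N|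
    @[N --> \oo] --> (0 : R).
  rewrite -[0](addr0 (0:R)) -[in X in X + _](normr0 R) -[in X in _ + X](normr0 R).
  apply: cvgD; apply: cvg_norm.
    by rewrite -(subrr (cos s)); apply: cvgB => //; exact: cvg_cst.
  by rewrite -(subrr (sin s)); apply: cvgB => //; exact: cvg_cst.
have psumE N : \sum_(n < N) ('i * s%:C) ^+ n / n`!%:R =
    series (cos_coeff s) N +i* series (sin_coeff s) N.
  rewrite /series /= !big_mkord; elim: N => [|N IH]; first by rewrite !big_ord0.
  by rewrite !big_ord_recr /= IH cexp_i_term; simpc.
apply: (squeeze_cvgr _ (cvg_cst (0 : R)) h0); near=> N.
rewrite normc_ge0 psumE cexp_iE /=; exact: normc_le_abs.
Unshelve. all: by end_near.
Qed.

(* With [t = i e^(i theta)], [i x cos theta = (x/2) t - (x/2) t^-1]; expand the powers of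
   this sum binomially and collect the coefficient of each [t ^ m]. *)
Lemma bessel_psum_trunc N x theta :
  normc (\sum_(n < N.+1) ('i * (x * cos theta)%:C) ^+ n / n`!%:R -
    bessel_psum N x theta) <= 4 * expR (4 * `|x / 2|) ^+ 2 * (1 / 2) ^+ N.
Proof.
set t : R[i] := 'i * cexp ('i * theta%:C).
have t1 : normc t = 1 by rewrite normcM normc_i normc_cexp_i mulr1.
have t0 : t != 0.
  by apply/eqP => e; move: t1; rewrite e ComplexField.Normc.normc0 => /esym/eqP; rewrite oner_eq0.
have tV : t - t^-1 = 2 * ('i * (cos theta)%:C).
  rewrite /t invfM -cexp_iN !cexp_iE cosN sinN.
  have -> : ('i : R[i])^-1 = - 'i.
    by apply: (mulfI (_ : 'i != 0)); [rewrite eq_complex /= oner_eq0 andbF|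
      rewrite divff; [rewrite mulrN -expr2 sqr_i opprK|rewrite eq_complex /= oner_eq0 andbF]].
  by apply/eqP; rewrite eq_complex /=; apply/andP; split; apply/eqP; ring.
pose y : R[i] := (x / 2)%:C.
have yE : y * 2 = x%:C.
  by rewrite /y -(rmorph_nat (real_complex R)) -rmorphM divfK.
pose f a b := (y * t) ^+ a / a`!%:R * ((- y * t^-1) ^+ b / b`!%:R).
have -> : \sum_(n < N.+1) ('i * (x * cos theta)%:C) ^+ n / n`!%:R =
    \sum_(n < N.+1) \sum_(b < n.+1) f (n - b)%N b.
  apply: eq_bigr => n _.
  have -> : 'i * (x * cos theta)%:C = y * t + - y * t^-1.
    by rewrite mulNr -mulrBr tV (mulrA y) yE rmorphM mulrCA.
  rewrite exprDn mulr_suml; apply: eq_bigr => b _; rewrite /f.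
  have bn : (b <= n)%N by rewrite -ltnS.
  rewrite -mulr_natr mulf_div -!mulrA; congr (_ * (_ * _)).
  rewrite -natrM -(bin_fact bn) [(_`! * (n - b)`!)%N]mulnC.
  rewrite natrM invfM mulrA divff ?mul1r//.
  by rewrite pnatr_eq0 -lt0n bin_gt0.
rewrite sum_antidiag /bessel_psum.
pose F l := t ^ l * (besselJ l x)%:C.
have -> : \sum_(i < 2 * N + 1) 'i ^ centered i *
    cexp ('i * ((centered i)%:~R * theta)%:C) * (besselJ (centered i) x)%:C =
    \sum_(i < 2 * N + 1) F (centered i).
  by apply: eq_bigr => i _; rewrite cexp_iMz /F /t (expfzMl 'i).
clearbody t.
rewrite sum_centered opprD addrACA -!sumrB.
set E := expR _ ^+ 2.
have E0 : 0 <= E by rewrite exprn_ge0// expR_ge0.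
(* Only degrees above [N] are omitted at each order, hence a common bound. The sign [s] serves
   [J_{-m} = (-1)^m J_m]. *)
have err (l : int) (s : R) (m K : nat) : (N.+1 <= 2 * K + m)%N -> `|s| = 1 ->
    normc (t ^ l * (s * \sum_(k < K) bessel_term m x k)%:C - t ^ l * (s * besselJ_nat m x)%:C) <=
    2 * (E * (1 / 4) ^+ N).
  move=> hK hs; rewrite -mulrBr -rmorphB -mulrBr normcM normc_unit_exprz// (mul1r (normc _)).
  rewrite normc_real normrM hs (mul1r `|_|) distrC (le_trans (besselJ_nat_tail _ _ _))//.
  rewrite ler_wpM2l// ler_wpM2l// ler_wiXn2l; [by []|lra|lra|lia].
have bound : normc (\sum_(m < N.+1) (\sum_(k < uphalf (N.+1 - m)) f (k + m)%N k - F m%:Z) +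
    \sum_(m < N) (\sum_(k < uphalf (N - m)) f k (k + m.+1)%N - F (Negz m))) <=
    \sum_(m < N.+1) 2 * (E * (1 / 4) ^+ N) + \sum_(m < N) 2 * (E * (1 / 4) ^+ N).
  apply: (le_trans (normcD _ _)); apply: lerD; apply: (le_trans (normc_sum _ _ _));
    apply: ler_sum => m _.
    (* In [f (k + m) k] the powers of [t] reduce to [t ^ m], and the rest is the [k]-th Bessel
       term. *)
    rewrite (_ : \sum_(k < _) _ = t ^ m%:Z * (1 * \sum_(k < uphalf (N.+1 - m)) bessel_term m x k)%:C).
      rewrite /F /= -[besselJ_nat m x]mul1r; apply: err; last exact: normr1.
      by have := ltn_ord m; lia.
    rewrite mul1r rmorph_sum mulr_sumr /=; apply: eq_bigr => k _.
    rewrite bessel_termC -/y /f; clearbody y.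
    rewrite !exprMn [(- y) ^+ _]exprNn exprVn -exprnP.
    rewrite mul2n -addnn -addnA !(exprD y) (exprD t).
    have k0 : (k`!%:R : R[i]) != 0 by rewrite pnatr_eq0 -lt0n fact_gt0.
    have km0 : ((k + m)`!%:R : R[i]) != 0 by rewrite pnatr_eq0 -lt0n fact_gt0.
    have tk0 : t ^+ k != 0 by rewrite expf_neq0.
    by field; rewrite k0 km0 tk0.
  (* With the two exponents exchanged the sign is [(-1) ^+ (k + m.+1)], which yields the extra sign
     of the negative order. *)
  rewrite (_ : \sum_(k < _) _ = t ^ (Negz m) *
      ((-1) ^+ m.+1 * \sum_(k < uphalf (N - m)) bessel_term m.+1 x k)%:C).
    rewrite /F /=; apply: err; last by rewrite normrX normrN1 expr1n.
    by have := ltn_ord m; lia.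
  rewrite rmorphM /= rmorph_sign rmorph_sum !mulr_sumr /=; apply: eq_bigr => k _.
  rewrite bessel_termC -/y /f; clearbody y.
  rewrite !exprMn [(- y) ^+ _]exprNn exprVn NegzE -exprnN.
  rewrite mul2n -addnn -addnA !(exprD y) (exprD t).
  have k0 : (k`!%:R : R[i]) != 0 by rewrite pnatr_eq0 -lt0n fact_gt0.
  have km0 : ((k + m.+1)`!%:R : R[i]) != 0 by rewrite pnatr_eq0 -lt0n fact_gt0.
  have tk0 : t ^+ k != 0 by rewrite expf_neq0.
  have tm0 : t ^+ m.+1 != 0 by rewrite expf_neq0.
  rewrite [(-1) ^+ (k + m.+1)]exprD.
  by field; rewrite k0 km0 tk0 tm0.
(* There are [2 * N + 1] orders, and [(2 * N + 1) / 2 ^ N <= 2]: one of the two factors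
   [(1 / 2) ^+ N] in [(1 / 4) ^+ N] absorbs their number and leaves the constant 4. *)
apply: (le_trans bound); rewrite !sumr_const !card_ord -mulrnDr -[_ *+ (N.+1 + N)]mulr_natr.
have -> : (1 / 4 : R) ^+ N = (1 / 2) ^+ N * (1 / 2) ^+ N.
  by rewrite -exprMn; congr (_ ^+ _); field.
have : (N.+1 + N)%:R * (1 / 2 : R) ^+ N <= 2.
  rewrite expr_div_n expr1n mulrA mulr1 ler_pdivrMr ?exprn_gt0//.
  by rewrite -natrX -natrM ler_nat; have := ltn_expl N (isT : 1 < 2)%N; lia.
have : 0 <= E * (1 / 2 : R) ^+ N by rewrite mulr_ge0// exprn_ge0//; lra.
set a := (N.+1 + N)%:R; set b := (1 / 2) ^+ N; move=> h1 h2.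
have -> : 2 * (E * (b * b)) * a = 2 * (E * b) * (a * b) by ring.
have -> : 4 * E * b = 2 * (E * b) * 2 by ring.
by rewrite ler_wpM2l// mulr_ge0.
Qed.

(** The Taylor polynomial of degree [N] lies in between: it tends to the exponential and is
    geometrically close to the Bessel partial sum. *)
Lemma jacobi_anger x theta :
  normc (cexp ('i * (x * cos theta)%:C) - bessel_psum N x theta)
    @[N --> \oo] --> (0 : R).
Proof.
pose E n := \sum_(k < n) ('i * (x * cos theta)%:C) ^+ k / k`!%:R : R[i].
have h1 : normc (cexp ('i * (x * cos theta)%:C) - E N.+1) +
    4 * expR (4 * `|x / 2|) ^+ 2 * (1 / 2) ^+ N @[N --> \oo] --> (0 : R).
  rewrite -[0](addr0 (0:R)); apply: cvgD.
    by rewrite (cvg_shiftS (fun N => normc (_ - E N))); exact: cvg_cexp_i_psum.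
  by apply: cvg_geometric; rewrite ger0_norm; lra.
apply: (squeeze_cvgr _ (cvg_cst (0 : R)) h1); near=> N.
rewrite normc_ge0 /=.
rewrite -[cexp _ - _](subrKA (E N.+1)) (le_trans (normcD _ _))// lerD//.
exact: bessel_psum_trunc.
Unshelve. all: by end_near.
Qed.

End JacobiAnger.

(** * Truncation error of a product of two Jacobi-Anger series *)

Section TruncationTail.
Variable R : realType.
Implicit Types (x y theta phi : R) (N I : nat).

(** The ordinals of the two windows carry different offsets, so the sums are compared after
    splitting them into nonnegative and negative orders. *)
Lemma sum_centered_sub (V : nmodType) (F : int -> V) I N : (I <= N)%N ->
  \sum_(i < 2 * N + 1 | (`|centered i| <= I)%N) F (centered i) =
  \sum_(i < 2 * I + 1) F (centered i).
Proof.
move=> IN; rewrite big_mkcond /=.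
rewrite (sum_centered (fun l => if (`|l| <= I)%N then F l else 0)) sum_centered.
rewrite -!big_mkcond /= (big_ord_widen N.+1 (fun m => F m%:Z))//.
by rewrite (big_ord_widen N (fun m => F (Negz m))).
Qed.

Lemma centered_inj N : injective (@centered N).
Proof. by move=> i j /addIr[] /val_inj. Qed.

(** An [\esum] is a supremum over finite subsets, and the filtered window is one of them, listed
    without repetition because [centered] is injective. *)
Lemma esum_centered_ge (f : int -> \bar R) (P : pred int) N :
  (\sum_(i < 2 * N + 1 | P (centered i)) f (centered i) <=
   \esum_(l in [set l | P l]) f l)%E.
Proof.
pose s := [seq centered i | i <- [seq i <- enum 'I_(2 * N + 1) | P (centered i)]].
apply: esum_ge; exists [set` s].
  split; first exact: finite_seq.
  by move=> l; case/mapP => i; rewrite mem_filter => /andP[Pi _] ->.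
rewrite -fsbig_seq; last first.
  by rewrite (map_inj_uniq (@centered_inj N)) filter_uniq// enum_uniq.
by rewrite big_map big_filter big_enum_cond.
Qed.

Lemma esum2_centered_ge (g : int -> int -> R) (P : pred int) N :
  (forall l q, 0 <= g l q) ->
  ((\sum_(i < 2 * N + 1 | P (centered i))
      \sum_(j < 2 * N + 1) g (centered i) (centered j))%:E <=
   \esum_(l in [set l | P l]) \esum_(q in [set: int]) (g l q)%:E)%E.
Proof.
move=> g0; rewrite -sumEFin.
apply: le_trans (esum_centered_ge (fun l => \esum_(q in [set: int]) (g l q)%:E) P N).
apply: lee_sum => i _; rewrite -sumEFin.
have -> : [set: int] = [set q | xpredT q] by apply/seteqP; split.
exact: (esum_centered_ge (fun q => (g (centered i) q)%:E) xpredT N).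
Qed.

Lemma normc_psum_term (l : int) x theta :
  normc ('i ^ l * cexp ('i * (l%:~R * theta)%:C) * (besselJ l x)%:C) =
  `|besselJ l x|.
Proof.
rewrite 2!normcM normc_real normc_cexp_i normc_unit_exprz ?normc_i//.
by rewrite !mul1r.
Qed.

Lemma bessel_psum_sub I N x theta : (I <= N)%N ->
  bessel_psum N x theta - bessel_psum I x theta =
  \sum_(i < 2 * N + 1 | (I < `|centered i|)%N) 'i ^ centered i *
    cexp ('i * ((centered i)%:~R * theta)%:C) * (besselJ (centered i) x)%:C.
Proof.
move=> IN; rewrite /bessel_psum.
rewrite -(sum_centered_sub (fun l => 'i ^ l *
    cexp ('i * (l%:~R * theta)%:C) * (besselJ l x)%:C) IN).
rewrite (bigID (fun i : 'I_(2 * N + 1) => (`|centered i| <= I)%N)) /= addrAC subrr add0r.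
by apply: eq_bigl => i; rewrite ltnNge.
Qed.

(** The wider window [N] is what the unrestricted inner sums of the two tails require. *)
Lemma normc_bessel_psum I N x theta : (I <= N)%N ->
  normc (bessel_psum I x theta) <=
  \sum_(i < 2 * N + 1) `|besselJ (centered i) x|.
Proof.
move=> IN; rewrite (bigID (fun i : 'I_(2 * N + 1) => (`|centered i| <= I)%N)) /=.
rewrite (sum_centered_sub (fun l => `|besselJ l x|) IN).
apply: (le_trans (normc_sum _ _ _)).
rewrite [leLHS](eq_bigr (fun i => `|besselJ (centered i) x|)); last first.
  by move=> i _; exact: normc_psum_term.
by rewrite lerDl sumr_ge0.
Qed.

Lemma normc_psum_sub I N x theta : (I <= N)%N ->
  normc (bessel_psum N x theta - bessel_psum I x theta) <=
  \sum_(i < 2 * N + 1 | (I < `|centered i|)%N) `|besselJ (centered i) x|.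
Proof.
move=> IN; rewrite bessel_psum_sub// (le_trans (normc_sum _ _ _))//.
apply: ler_sum => i _.
by rewrite le_eqVlt; apply/orP; left; apply/eqP; exact: normc_psum_term.
Qed.

Lemma normc_subM (z w z' w' : R[i]) :
  normc (z * w - z' * w') <= normc (z - z') * normc w + normc z' * normc (w - w').
Proof.
have -> : z * w - z' * w' = (z - z') * w + z' * (w - w') by ring.
by rewrite (le_trans (normcD _ _))// !normcM.
Qed.

(** Both exponentials are first replaced by partial sums at a large common order [N], at a cost
    below any [e > 0]. The remaining difference of finite products telescopes into two finite double
    sums, each dominated by one of the two infinite tails. *)
Lemma truncation_tail I1 I2 x y theta phi :
  ((normc (cexp ('i * (x * cos theta)%:C) * cexp ('i * (y * cos phi)%:C) -
      bessel_psum I1 x theta * bessel_psum I2 y phi))%:E <=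
    \esum_(l in [set l : int | (I1 < `|l|)%N])
      \esum_(q in [set: int]) (`|besselJ l x| * `|besselJ q y|)%:E
    + \esum_(q in [set q : int | (I2 < `|q|)%N])
        \esum_(l in [set: int]) (`|besselJ l x| * `|besselJ q y|)%:E)%E.
Proof.
set X := cexp ('i * (x * cos theta)%:C); set Y := cexp ('i * (y * cos phi)%:C).
pose u N := normc (X - bessel_psum N x theta).
pose v N := normc (Y - bessel_psum N y phi).
(* This bounds the cost of passing to order [N]: [Y] has modulus 1 and the partial sum for [X] has
   modulus at most [1 + u N]. *)
have uv0 : u N + (1 + u N) * v N @[N --> \oo] --> (0 : R).
  have -> : (0 : R) = 0 + (1 + 0) * 0 by rewrite mulr0 addr0.
  have hu := @jacobi_anger R x theta; have hv := @jacobi_anger R y phi.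
  apply: cvgD => //; apply: cvgM => //.
  by apply: cvgD => //; exact: cvg_cst.
apply/lee_addgt0Pr => e e0.
near \oo => N.
have I1N : (I1 <= N)%N by near: N; exact: nbhs_infty_ge.
have I2N : (I2 <= N)%N by near: N; exact: nbhs_infty_ge.
have small : u N + (1 + u N) * v N <= e.
  by apply: ltW; near: N; exact: (cvgr_lt 0 uv0).
have step1 : normc (X * Y - bessel_psum N x theta * bessel_psum N y phi) <= e.
  apply: le_trans (normc_subM _ _ _ _) (le_trans _ small).
  rewrite normc_cexp_i mulr1 lerD2l ler_wpM2r ?normc_ge0//.
  rewrite -[bessel_psum N x theta](subKr X) (le_trans (normcD _ _))//.
  by rewrite normcN normc_cexp_i.
have step2 : normc (bessel_psum N x theta * bessel_psum N y phi -
    bessel_psum I1 x theta * bessel_psum I2 y phi) <=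
  \sum_(i < 2 * N + 1 | (I1 < `|centered i|)%N) \sum_(j < 2 * N + 1)
     `|besselJ (centered i) x| * `|besselJ (centered j) y| +
  \sum_(j < 2 * N + 1 | (I2 < `|centered j|)%N) \sum_(i < 2 * N + 1)
     `|besselJ (centered i) x| * `|besselJ (centered j) y|.
  apply: (le_trans (normc_subM _ _ _ _)); apply: lerD.
    under eq_bigr do rewrite -mulr_sumr.
    by rewrite -mulr_suml ler_pM ?normc_ge0 ?normc_psum_sub ?normc_bessel_psum.
  under eq_bigr do rewrite -mulr_suml.
  by rewrite -mulr_sumr ler_pM ?normc_ge0 ?normc_psum_sub ?normc_bessel_psum.
have := @esum2_centered_ge (fun l q => `|besselJ l x| * `|besselJ q y|)
  (fun l => (I1 < `|l|)%N) N.
have := @esum2_centered_ge (fun q l => `|besselJ l x| * `|besselJ q y|)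
  (fun q => (I2 < `|q|)%N) N.
move=> /(_ (fun _ _ => mulr_ge0 (normr_ge0 _) (normr_ge0 _))) h2.
move=> /(_ (fun _ _ => mulr_ge0 (normr_ge0 _) (normr_ge0 _))) h1.
apply: le_trans (leeD2r _ (leeD h1 h2)).
rewrite -!EFinD lee_fin [leRHS]addrC.
rewrite -[X * Y - _](subrKA (bessel_psum N x theta * bessel_psum N y phi)).
by rewrite (le_trans (normcD _ _))// lerD.
Unshelve. all: by end_near.
Qed.

End TruncationTail.

(** * The lifted measurement as a product of truncated series *)

Section LiftedMeasurement.
Variable R : realType.
Variables (Nr Nd I1 I2 : nat) (p : pairs I1 I2 -> 'I_(nbP I1 I2)).
Variables (k d : R) (rg : 'I_Nd -> R).
Hypothesis p_bij : bijective p.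

(** The conjugation in the inner product undoes the one in the atom, and the one-sparse factor
    selects row [i0] of [Y]. *)
Lemma mxinner_lifted_atom (r theta : R) (i0 : 'I_Nd) (Y : 'M[R[i]]_(Nd, Nb I1 I2)) :
  (forall i, (r == rg i) = (i == i0)) ->
  mxinner (lifted_atom I1 I2 rg r theta) Y =
  \sum_b vandermonde I1 I2 theta b 0 * Y i0 b.
Proof.
move=> hr; rewrite /mxinner /mxtrace; apply: eq_bigr => b _.
rewrite mxE (bigD1 i0)//= big1 ?addr0.
  rewrite /lifted_atom !mxE big_ord_recl big_ord0 addr0 !mxE hr eqxx mul1r.
  by rewrite conjCK.
move=> i ii0; rewrite /lifted_atom !mxE big_ord_recl big_ord0 addr0 !mxE hr.
by rewrite (negbTE ii0) mul0r rmorph0 mul0r.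
Qed.

(** Position [(a, n)] of [vec] holds entry [(n, a)], so these 0-1 entries make the measurement read
    row [n] of each coefficient matrix. *)
Lemma kron_delta_mxE (n : 'I_Nr) s a :
  castmx (erefl, muln1 (nbP I1 I2)) (1%:M *t (delta_mx n 0 : 'cV[R[i]]_Nr)) s a =
  (s == mxtens_index (a, n))%:R.
Proof.
rewrite castmxE cast_ord_id.
have -> : cast_ord (esym (muln1 (nbP I1 I2))) a = mxtens_index (a, ord0).
  by apply/val_inj; rewrite /= muln1 addn0.
case: (mxtens_indexP s) => i j.
rewrite (can_eq (@mxtens_indexK _ _)) xpair_eqE tensmxE !mxE eqxx andbT.
by rewrite -natrM mulnb.
Qed.

Lemma measmxE (n : 'I_Nr) i b :
  measmx p k d rg n i b = (Num.sqrt (Nb I1 I2)%:R)%:C *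
    \sum_a coefmx Nr p k d (rg i) n a * selection R p a b.
Proof.
rewrite /measmx mxE; congr (_ * _); rewrite mxE; apply: eq_bigr => a _.
congr (_ * _); rewrite mxE (bigD1 (mxtens_index (a, n)))//= big1 ?addr0.
  rewrite kron_delta_mxE eqxx mulr1 /dictionary /vec mxE mxE [in LHS]mxE.
  by rewrite mxtens_indexK.
by move=> s hs; rewrite kron_delta_mxE (negbTE hs) mulr0.
Qed.

Lemma coefmx_pE (n : 'I_Nr) (rho : R) lq :
  coefmx Nr p k d rho n (p lq) =
  cexp (- 'i * (z2 k d n rho)%:C) * 'i ^ (centered lq.1 + centered lq.2) *
    (besselJ (centered lq.1) (z1 k d n))%:C *
    (besselJ (centered lq.2) (z2 k d n rho))%:C.
Proof.
rewrite mxE (big_pred1 lq)// => lq' /=.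
by rewrite (inj_eq (bij_inj p_bij)).
Qed.

Lemma selection_pE l q b : selection R p (p (l, q)) b =
  (b%:Z == centered l + 2 * centered q + (Ioff I1 I2)%:Z)%:R.
Proof.
rewrite mxE; congr ((nat_of_bool _)%:R); apply/idP/idP.
  move=> /existsP[l' /existsP[q' /andP[/eqP e]]].
  by case: (bij_inj p_bij e) => -> ->.
by move=> h; apply/existsP; exists l; apply/existsP; exists q; rewrite eqxx.
Qed.

Lemma sum_selection (w : int -> R[i]) l q :
  \sum_(b < Nb I1 I2) selection R p (p (l, q)) b * w (b%:Z - (Ioff I1 I2)%:Z) =
  w (centered l + 2 * centered q).
Proof.
(* The offset [Ioff = I1 + 2 * I2] cancels both centerings: the selected column is the natural
   number [l + 2 * q], always in range. *)
have lt_b : (l + 2 * q < Nb I1 I2)%N.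
  by have := ltn_ord l; have := ltn_ord q; rewrite /Nb /Ioff; lia.
have eb : (l + 2 * q)%N%:Z = centered l + 2 * centered q + (Ioff I1 I2)%:Z.
  by rewrite /centered /Ioff; lia.
rewrite (bigD1 (Ordinal lt_b))//= big1 ?addr0.
  by rewrite selection_pE /= eb eqxx mul1r addrK.
move=> b hb; rewrite selection_pE -eb.
have /negbTE -> : b%:Z != (l + 2 * q)%N%:Z by exact: hb.
by rewrite mul0r.
Qed.

(** The normalisations by [sqrt Nb] cancel. The selected frequency [l + 2 q] gives
    [e^(i l theta) e^(i q (2 theta))], so the double sum separates into partial sums at the angles
    [theta] and [2 * theta]. *)
Lemma mxinner_measmx (n : 'I_Nr) (r theta : R) : (exists! i, r = rg i) ->
  mxinner (lifted_atom I1 I2 rg r theta) (measmx p k d rg n) =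
  cexp (- 'i * (z2 k d n r)%:C) *
    (bessel_psum I1 (z1 k d n) theta * bessel_psum I2 (z2 k d n r) (2 * theta)).
Proof.
move=> [i0 [ri0 uniq_i0]].
rewrite (@mxinner_lifted_atom r theta i0); last first.
  move=> i; apply/eqP/eqP => [/uniq_i0 //|->//].
set s : R := Num.sqrt (Nb I1 I2)%:R.
have s0 : s%:C != 0 :> R[i].
  by rewrite (fmorph_eq0 (real_complex R)) sqrtr_eq0 -ltNge ltr0n /Nb addn1.
pose w (m : int) : R[i] := cexp ('i * (m%:~R * theta)%:C).
transitivity (\sum_(b < Nb I1 I2) w (b%:Z - (Ioff I1 I2)%:Z) *
    \sum_a coefmx Nr p k d (rg i0) n a * selection R p a b).
  apply: eq_bigr => b _; rewrite measmxE mxE -/s fmorphV -/(w _).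
  by rewrite mulrACA mulVf// mul1r.
under eq_bigr do rewrite mulr_sumr.
rewrite exchange_big /= (reindex p) /=; last exact: onW_bij.
transitivity (\sum_(lq : pairs I1 I2) coefmx Nr p k d (rg i0) n (p (lq.1, lq.2)) *
    w (centered lq.1 + 2 * centered lq.2)).
  apply: eq_bigr => -[l q] _; rewrite -(sum_selection w) mulr_sumr.
  by apply: eq_bigr => b _; rewrite mulrCA [w _ * _]mulrC.
rewrite -(pair_bigA _ (fun l q => coefmx Nr p k d (rg i0) n (p (l, q)) *
    w (centered l + 2 * centered q))) /=.
rewrite /bessel_psum mulr_suml mulr_sumr; apply: eq_bigr => l _.
rewrite !mulr_sumr; apply: eq_bigr => q _.
rewrite coefmx_pE -ri0 /= /w intrD intrM mulrDl cexp_iD.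
rewrite [2 * _ * theta]mulrAC [2 * theta * _]mulrC.
rewrite expfzDr; last by rewrite eq_complex /= oner_eq0 andbF.
by ring.
Qed.

End LiftedMeasurement.

(** * The Fresnel phase error and the final decomposition *)

Lemma fresnel_remainder (R : realType) (k d r theta : R) (n : nat) :
  0 <= k -> 0 <= d -> 0 < r ->
  normc (steeringNF k d r theta n -
    cexp (- 'i * (z2 k d n r)%:C) *
      (cexp ('i * (z1 k d n * cos theta)%:C) *
       cexp ('i * (z2 k d n r * cos (2 * theta))%:C))) <=
  25 * r * k * (n%:R ^+ 3 * d ^+ 3 / r ^+ 3).
Proof.
move=> k0 d0 r0; rewrite /steeringNF !cexp_NiE -!cexp_iD.
apply: (le_trans (cexp_i_lipschitz _ _)).
pose x := n%:R * d / r; pose c := cos theta.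
have rx : n%:R * d = r * x by rewrite /x mulrCA divff ?mulr1// gt_eqF.
have x0 : 0 <= x by rewrite /x divr_ge0 ?mulr_ge0 ?ler0n// ltW.
have hrange : range_at d r theta n = r * Num.sqrt (1 - 2 * x * c + x ^+ 2).
  rewrite /range_at rx -/c.
  have -> : r ^+ 2 + (r * x) ^+ 2 - 2 * r * (r * x) * c =
      r ^+ 2 * (1 - 2 * x * c + x ^+ 2) by ring.
  by rewrite sqrtrM ?sqr_ge0// sqrtr_sqr gtr0_norm.
have c1 : `|c| <= 1 by rewrite ler_norml cos_geN1 cos_le1.
set lhs := (X in `|X|).
(* Since [z2 = k r x^2 / 4] and [cos (2 theta) = 2 c^2 - 1], the terms [- z2 + z2 cos (2 theta)]
   equal [- k r x^2 (1 - c^2) / 2]. The phase difference is thus exactly [- k r] times the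
   square-root remainder. *)
have -> : lhs = - (k * r) *
  (Num.sqrt (1 - 2 * x * c + x ^+ 2) - 1 + x * c - x ^+ 2 * (1 - c ^+ 2) / 2).
  have z1E : z1 k d n = k * (r * x) by rewrite /z1 -mulrA rx.
  have z2E : z2 k d n r = k * (r * x) ^+ 2 / (4 * r).
    by rewrite /z2 -exprMn rx mulrA.
  have c2 : cos (2 * theta) = 2 * c ^+ 2 - 1.
    have -> : 2 * theta = theta + theta by ring.
    by rewrite cosD; have := cos2Dsin2 theta; rewrite /c; lra.
  rewrite /lhs hrange z1E z2E c2 -/c.
  by field; rewrite gt_eqF.
rewrite normrM normrN [`|k * r|]ger0_norm ?mulr_ge0 ?(ltW r0)//.
have -> : 25 * r * k * (n%:R ^+ 3 * d ^+ 3 / r ^+ 3) = k * r * (25 * x ^+ 3).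
  by rewrite /x !exprMn exprVn; ring.
by rewrite ler_wpM2l ?mulr_ge0 ?(ltW r0)//; exact: fresnel_sqrt_remainder.
Qed.

Theorem theorem1 (R : realType) (rmin rmax : R)
    (hrmin : 0 < rmin) (hrmax : rmin <= rmax) :
  exists K : R, 0 < K /\
  forall (Nr : nat) (hNr : (2 <= Nr)%N)
    (d lam : R) (hd : 0 < d) (hlam : 0 < lam)
    (I1 I2 : nat) (hI1 : (0 < I1)%N) (hI2 : (0 < I2)%N)
    (p : 'I_(2 * I1 + 1) * 'I_(2 * I2 + 1) -> 'I_((2 * I1 + 1) * (2 * I2 + 1)))
    (hp : bijective p)
    (Nd : nat) (rg : 'I_Nd -> R)
    (hrg : forall i, 0 < rg i) (hinj : injective rg)
    (theta r : R) (htheta0 : 0 < theta) (hthetapi : theta < pi)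
    (hr1 : rmin <= r) (hr2 : r <= rmax) (hr : exists! i, r = rg i)
    (n : 'I_Nr),
  let k := wavenumber lam in
  exists deltaF deltaT : R[i],
  [/\ steeringNF k d r theta n =
        mxinner (lifted_atom I1 I2 rg r theta) (measmx p k d rg n) +
        (deltaF + deltaT),
      ComplexField.Normc.normc deltaF <= K * k * (n%:R ^+ 3 * d ^+ 3 / r ^+ 3) &
      ((ComplexField.Normc.normc deltaT)%:E <=
        \esum_(l in [set l : int | (I1 < `|l|)%N])
          \esum_(q in [set: int])
            (`|besselJ l (z1 k d n)| * `|besselJ q (z2 k d n r)|)%:E
        + \esum_(q in [set q : int | (I2 < `|q|)%N])
            \esum_(l in [set: int])
              (`|besselJ l (z1 k d n)| * `|besselJ q (z2 k d n r)|)%:E)%E].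
Proof.
have rmax0 : 0 < rmax by exact: lt_le_trans hrmax.
(* The phase estimate carries [25 * r], one factor [r] coming from the rescaling [n d = r x];
   [r <= rmax] makes it uniform. *)
exists (25 * rmax); split; first by rewrite mulr_gt0.
move=> Nr _ d lam hd hlam I1 I2 _ _ p hp Nd rg _ _ theta r _ _ hr1 hr2 hr n k.
have r0 : 0 < r by exact: lt_le_trans hr1.
have k0 : 0 <= k by rewrite /k /wavenumber divr_ge0 ?mulr_ge0 ?pi_ge0 ?(ltW hlam).
pose fresnel := cexp (- 'i * (z2 k d n r)%:C) *
  (cexp ('i * (z1 k d n * cos theta)%:C) *
   cexp ('i * (z2 k d n r * cos (2 * theta))%:C)).
pose approx := mxinner (lifted_atom I1 I2 rg r theta) (measmx p k d rg n).
exists (steeringNF k d r theta n - fresnel), (fresnel - approx); split.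
- by rewrite subrKA addrC subrK.
- apply: (le_trans (fresnel_remainder _ _ k0 (ltW hd) r0)).
  rewrite ler_wpM2r ?ler_wpM2r ?ler_wpM2l//.
  by rewrite divr_ge0 ?mulr_ge0 ?exprn_ge0 ?ler0n ?(ltW hd) ?(ltW r0).
(* The common factor [e^(-j z2)] has modulus 1 and drops out. *)
rewrite /approx mxinner_measmx// /fresnel -mulrBr normcM cexp_NiE normc_cexp_i mul1r.
exact: truncation_tail.
Qed.
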